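(* Let $\{e_n\}_{n=0}^{\infty}\subseteq\ell^2(\mathbb{N})$ be the standard orthonormal basis. Then: (1) $\{(n+1)e_n\}_{n=0}^{\infty}$ is an ICO sequence and not an SCO sequence. (2) $\{(n+1)^{-1}e_n\}_{n=0}^{\infty}$ is not a CFC sequence. (3) $\{(n+1)e_n\}_{n=0}^{\infty}\cup\{(n+1)^{-1}e_n\}_{n=0}^{\infty}$ is a CFC sequence and not a CO sequence.
   Context: Let $\mathcal{H}=\ell^2(\mathbb{N})$. A countable family $\{f_n\}\subseteq\mathcal{H}$ is a CFC sequence if there is a bounded linear operator $B\in B(\mathcal{H})$ such that $\{Bf_n\}$ is a Parseval frame in $\mathcal{H}$, i.e. $\sum_n|\langle f,Bf_n\rangle|^2=\|f\|^2$ for all $f\in\mathcal{H}$. It is a CO sequence if there is $B\in B(\mathcal{H})$ such that $\{Bf_n\}$ is an orthonormal basis of $\mathcal{H}$; it is an ICO (respectively SCO) sequence if such a $B$ (making $\{Bf_n\}$ an orthonormal basis) can be chosen injective (respectively surjective). The union of two sequences denotes the combined family, counted with multiplicity. *)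

(* Defs.v *)
From HB Require Import structures.
From mathcomp Require Import all_boot all_order all_algebra.
From mathcomp Require Import complex.
From mathcomp Require Import all_classical all_reals all_analysis.

Set Implicit Arguments.
Unset Strict Implicit.
Unset Printing Implicit Defensive.

Import Order.TTheory GRing.Theory Num.Theory.
Import numFieldNormedType.Exports.

Local Open Scope classical_set_scope.
Local Open Scope complex_scope.
Local Open Scope ring_scope.

(* real-valued modulus; `|z| is convertible to (cabs z)%:C *)
Notation cabs := (@Normc.normc _).

Section SquareSummable.
Variable R : realType.
Implicit Types u v : nat -> R[i].

Definition sqsum u : \bar R := (\sum_(0 <= n <oo) (cabs (u n) ^+ 2)%:E)%E.

Definition sqsummable : {pred nat -> R[i]} := [pred u | (sqsum u < +oo)%E].

Lemma sqsum_ge0 u : (0 <= sqsum u)%E.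
Proof. by apply: nneseries_ge0 => n _ _; rewrite lee_fin sqr_ge0. Qed.

Lemma sqsummable_fin u : u \in sqsummable -> sqsum u \is a fin_num.
Proof. by rewrite inE => us; rewrite ge0_fin_numE// sqsum_ge0. Qed.

Lemma cabs_ge0 (z : R[i]) : 0 <= cabs z.
Proof. by case: z => a b; exact: sqrtr_ge0. Qed.

Lemma cabsD (y z : R[i]) : cabs (y + z) <= cabs y + cabs z.
Proof. by rewrite -lecR rmorphD/=; exact: (@ler_normD _ R[i]). Qed.

Definition l2norm u : R := Num.sqrt (fine (sqsum u)).

Let l2 (a : nat -> R) : \bar R := ('N[counting]_2%:E [EFin \o a])%E.

Let l2E u : l2 (cabs \o u) = (sqsum u `^ 2^-1)%E.
Proof.
rewrite /l2 Lnorm_counting//; congr (_ `^ _)%E.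
apply: eq_eseriesr => n _ /=.
by rewrite ger0_norm ?cabs_ge0// powR_mulrn ?cabs_ge0.
Qed.

Lemma l2normE u : u \in sqsummable -> (sqsum u `^ 2^-1)%E = (l2norm u)%:E.
Proof.
move=> /sqsummable_fin us; rewrite -(fineK us) poweR_EFin.
by rewrite powR12_sqrt// fine_ge0// sqsum_ge0.
Qed.

Let minkowski2 u v :
  (sqsum (u + v)%R `^ 2^-1 <= sqsum u `^ 2^-1 + sqsum v `^ 2^-1)%E.
Proof.
rewrite -!l2E.
apply: (@le_trans _ _ (l2 ((cabs \o u) \+ (cabs \o v)))).
  rewrite !{1}/l2 !Lnorm_counting//; apply: gt0_ler_poweR => //.
  - by rewrite in_itv/= leey andbT nneseries_ge0.
  - by rewrite in_itv/= leey andbT nneseries_ge0.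
  apply: lee_nneseries => n _ //=.
  rewrite lee_fin ge0_ler_powR ?nnegrE ?normr_ge0//.
  by rewrite !ger0_norm ?addr_ge0 ?cabs_ge0// cabsD.
by apply: minkowski_EFin => //; rewrite ler1n.
Qed.

Lemma sqsumZ (c : R[i]) u : sqsum (c *: u) = ((cabs c ^+ 2)%:E * sqsum u)%E.
Proof.
rewrite /sqsum -nneseriesZl//; last by move=> n _; rewrite lee_fin sqr_ge0.
by apply: eq_eseriesr => n _; rewrite -EFinM -exprMn -Normc.normcM.
Qed.

Lemma sqsummable_submod_closed : submod_closed sqsummable.
Proof.
split=> [|c u v].
  rewrite inE /sqsum eseries0// => n _ _.
  by rewrite Normc.normc0 expr0n.
move=> us vs.
have cus : c *: u \in sqsummable.
  by rewrite inE sqsumZ -(fineK (sqsummable_fin us)) -EFinM ltry.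
rewrite inE (@lty_poweRy _ _ 2^-1) ?invr_eq0 ?pnatr_eq0//.
by rewrite (le_lt_trans (minkowski2 _ _))// !l2normE// -EFinD ltry.
Qed.

HB.instance Definition _ := GRing.isSubmodClosed.Build _ _ sqsummable
  sqsummable_submod_closed.

Lemma l2normD u v : u \in sqsummable -> v \in sqsummable ->
  l2norm (u + v) <= l2norm u + l2norm v.
Proof.
move=> us vs; have uvs : u + v \in sqsummable by exact: rpredD.
by rewrite -lee_fin EFinD -!l2normE// minkowski2.
Qed.

Lemma l2normZ (c : R[i]) u : u \in sqsummable ->
  l2norm (c *: u) = cabs c * l2norm u.
Proof.
move=> us; rewrite /l2norm sqsumZ -(fineK (sqsummable_fin us)) -EFinM/=.
by rewrite sqrtrM ?sqr_ge0// sqrtr_sqr ger0_norm ?cabs_ge0.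
Qed.

Lemma l2norm_eq0 u : u \in sqsummable -> l2norm u = 0 -> u = 0.
Proof.
move=> us /eqP; rewrite sqrtr_eq0 => u0.
have {}u0 : (sqsum u = 0)%E.
  apply/eqP; rewrite eq_le sqsum_ge0 andbT -(fineK (sqsummable_fin us)).
  by rewrite lee_fin.
apply/funext => n; apply: Normc.eq0_normc.
apply/eqP; rewrite -sqrf_eq0 eq_le sqr_ge0 andbT -lee_fin -[leRHS]u0.
rewrite /sqsum (@nneseriesD1 _ _ n)//; last by move=> k _; rewrite lee_fin sqr_ge0.
by rewrite leeDl// nneseries_ge0// => k _ _; rewrite lee_fin sqr_ge0.
Qed.

End SquareSummable.

Record ell2 (R : realType) := Ell2 {
  ell2_val :> nat -> R[i] ;
  ell2P : ell2_val \in @sqsummable R }.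

HB.instance Definition _ (R : realType) := [isSub for @ell2_val R].
HB.instance Definition _ (R : realType) := [Choice of ell2 R by <:].
HB.instance Definition _ (R : realType) :=
  [SubChoice_isSubLmodule of ell2 R by <:].

Section Ell2Normed.
Variable R : realType.
Implicit Types f g : ell2 R.

Definition ell2norm f : R[i] := (l2norm f)%:C.

Let ell2normD f g : ell2norm (f + g) <= ell2norm f + ell2norm g.
Proof. by rewrite -rmorphD lecR l2normD ?ell2P. Qed.

Let ell2normZ (c : R[i]) f : ell2norm (c *: f) = `|c| * ell2norm f.
Proof. by rewrite /ell2norm l2normZ ?ell2P// rmorphM. Qed.

Let ell2norm_eq0 f : ell2norm f = 0 -> f = 0.
Proof. by move=> /complexI/l2norm_eq0 => /(_ (ell2P f)) f0; exact/val_inj. Qed.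

HB.instance Definition _ := Lmodule_isNormed.Build R[i] (ell2 R)
  ell2normD ell2normZ ell2norm_eq0.

End Ell2Normed.

Section Ell2Frames.
Variable R : realType.
Local Notation H := (ell2 R).

(* linear in the first argument; the series converges absolutely by
   Cauchy-Schwarz, so the limit is never a default value *)
Definition inner (f g : H) : R[i] :=
  limn (series (fun n => f n * conjc (g n) : R[i]^o)).

Let delta_sqsummable (n : nat) :
  (fun k => (k == n)%:R : R[i]) \in @sqsummable R.
Proof.
rewrite inE /sqsum (@nneseriesD1 _ _ n)//; last first.
  by move=> k _; rewrite lee_fin sqr_ge0.
rewrite eseries0 ?adde0 ?ltry// => k _ /negPf /= ->.
by rewrite Normc.normc0 expr0n.
Qed.

Definition std_basis (n : nat) : H := Ell2 (delta_sqsummable n).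

Definition bounded_linear (B : {linear H -> H}) : Prop :=
  exists M : R, forall f : H, `|B f| <= M%:C * `|f|.

Definition lin_span (I : choiceType) (v : I -> H) : set H :=
  [set f | exists (s : seq I) (c : I -> R[i]), f = \sum_(i <- s) c i *: v i].

Definition orthonormal (I : choiceType) (v : I -> H) : Prop :=
  forall i j : I, inner (v i) (v j) = (i == j)%:R.

Definition orthonormal_basis (I : choiceType) (v : I -> H) : Prop :=
  orthonormal v /\ dense (lin_span v).

Definition parseval_frame (I : choiceType) (v : I -> H) : Prop :=
  forall f : H,
    (\esum_(i in [set: I]) (cabs (inner f (v i)) ^+ 2)%:E
     = (l2norm f ^+ 2)%:E)%E.

Definition CFC_sequence (I : countType) (v : I -> H) : Prop :=
  exists B : {linear H -> H}, bounded_linear B /\ parseval_frame (B \o v).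

Definition CO_sequence (I : countType) (v : I -> H) : Prop :=
  exists B : {linear H -> H}, bounded_linear B /\ orthonormal_basis (B \o v).

Definition ICO_sequence (I : countType) (v : I -> H) : Prop :=
  exists B : {linear H -> H},
    [/\ bounded_linear B, injective B & orthonormal_basis (B \o v)].

Definition SCO_sequence (I : countType) (v : I -> H) : Prop :=
  exists B : {linear H -> H},
    [/\ bounded_linear B, (forall g, exists f, B f = g) & orthonormal_basis (B \o v)].

(* the disjoint index type keeps multiplicities *)
Definition family_union (I J : countType) (v : I -> H) (w : J -> H) :
    (I + J)%type -> H :=
  fun k => match k with inl i => v i | inr j => w j end.

End Ell2Frames.

(* Main.v *)
From HB Require Import structures.
Require Import Defs.
From mathcomp Require Import all_boot all_order all_algebra.
From mathcomp Require Import complex.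
From mathcomp Require Import all_classical all_reals all_analysis.
From mathcomp Require Import ring lra.

Set Implicit Arguments.
Unset Strict Implicit.
Unset Printing Implicit Defensive.

Import Order.TTheory GRing.Theory Num.Theory.
Import numFieldNormedType.Exports.

Local Open Scope classical_set_scope.
Local Open Scope complex_scope.
Local Open Scope ring_scope.

(**
  Write e_n for the standard basis, u_n = (n+1) e_n and d_n = e_n / (n+1).

  The positive claims are witnessed by diagonal operators: the multiplier
  1/(n+1) sends u_n to e_n and is injective, and the multiplier
  ((n+1)^2 + (n+1)^-2)^(-1/2) sends u_n and d_n to multiples of e_n whose
  squared moduli add up to 1, so that the image of the union is a Parseval
  frame.

  The union is not a CO sequence because u_0 = d_0: a repeated vector cannot be
  orthogonal to itself and of norm 1.

  The sequence (d_n) is not CFC by a Hilbert-Schmidt argument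
  ([down_not_CFC]). If (B d_n) were a Parseval frame, evaluating the Parseval
  identity at e_k and summing over k would give the trace of the identity,
  which is infinite. Exchanging the two sums, the same quantity is
  sum_n ||B d_n||^2 <= ||B||^2 sum_n (n+1)^-2, which is finite.

  The sequence (u_n) is not SCO ([orthonormal_up_not_surjective]). Put
  b_n = B u_n, an orthonormal family, so that B e_n = b_n / (n+1). The series
  sum_n b_n / (n+1) converges to some g since its coefficients are square
  summable ([orthonormal_synthesis], which rests on the completeness of l^2,
  [ell2_complete]). If g = B f, comparing coefficients along (b_n) forces
  f_n = 1 for all n, and the constant sequence 1 is not square summable.
*)

(** * Complex moduli and complex sequences *)

Section ComplexSequences.
Variable R : realType.
Implicit Types (z : R[i]) (u : nat -> R[i]).

Lemma cabs_sqr z : cabs z ^+ 2 = complex.Re z ^+ 2 + complex.Im z ^+ 2.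
Proof. by case: z => a b /=; rewrite sqr_sqrtr ?addr_ge0 ?sqr_ge0. Qed.

Lemma normr_Re_le z : `|complex.Re z| <= cabs z.
Proof.
rewrite -(@ler_pXn2r _ 2) ?nnegrE ?normr_ge0 ?cabs_ge0//.
by rewrite cabs_sqr real_normK ?num_real// lerDl sqr_ge0.
Qed.

Lemma normr_Im_le z : `|complex.Im z| <= cabs z.
Proof.
rewrite -(@ler_pXn2r _ 2) ?nnegrE ?normr_ge0 ?cabs_ge0//.
by rewrite cabs_sqr real_normK ?num_real// lerDr sqr_ge0.
Qed.

Lemma mulc_conj z : z * conjc z = (cabs z ^+ 2)%:C.
Proof. by rewrite -sqr_normc rmorphXn. Qed.

Lemma cabs_natr n : cabs (n%:R : R[i]) = n%:R.
Proof.
rewrite -(rmorph_nat (real_complex R)) /=.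
by rewrite expr0n addr0 sqrtr_sqr ger0_norm.
Qed.

Lemma Re_sub (y z : R[i]) : complex.Re (y - z) = complex.Re y - complex.Re z.
Proof. by case: y; case: z. Qed.

Lemma Im_sub (y z : R[i]) : complex.Im (y - z) = complex.Im y - complex.Im z.
Proof. by case: y; case: z. Qed.

Lemma cabs_conj z : cabs (conjc z) = cabs z.
Proof. by apply: complexI; exact: normcJ. Qed.

Lemma cabs_real (x : R) : cabs x%:C = `|x|.
Proof. by rewrite /= expr0n addr0 sqrtr_sqr. Qed.

Lemma cvg_real_complex (a : nat -> R) (x : R) :
  a @ \oo --> x -> (fun n => (a n)%:C : R[i]^o) @ \oo --> (x%:C : R[i]^o).
Proof.
move=> /cvgrPdist_le ax; apply/cvgrPdist_le => e e0.
have eE : e = (complex.Re e)%:C by rewrite RRe_real// gtr0_real.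
have re0 : 0 < complex.Re e by rewrite -ltcR -eE.
near=> n; rewrite -rmorphB [leLHS](_ : _ = (cabs (x - a n)%:C)%:C)//.
by rewrite cabs_real eE lecR; near: n; exact: ax.
Unshelve. all: by end_near. Qed.

Lemma cvg_complex u (x y : R) :
  (fun n => complex.Re (u n)) @ \oo --> x ->
  (fun n => complex.Im (u n)) @ \oo --> y ->
  (u : nat -> R[i]^o) @ \oo --> (x +i* y : R[i]^o).
Proof.
move=> ux uy; rewrite [_ +i* _]complexE/=.
have -> : u = fun n => (complex.Re (u n))%:C + 'i * (complex.Im (u n))%:C.
  by apply/funext => n; exact: complexE.
apply: cvgD; first exact: cvg_real_complex.
by apply: cvgMl_tmp; exact: cvg_real_complex.
Qed.

Lemma Re_sum (I : Type) (s : seq I) (P : pred I) (F : I -> R[i]) :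
  complex.Re (\sum_(i <- s | P i) F i) = \sum_(i <- s | P i) complex.Re (F i).
Proof. by apply: (big_morph (@complex.Re R)) => // -[a b] [c d]. Qed.

Lemma Im_sum (I : Type) (s : seq I) (P : pred I) (F : I -> R[i]) :
  complex.Im (\sum_(i <- s | P i) F i) = \sum_(i <- s | P i) complex.Im (F i).
Proof. by apply: (big_morph (@complex.Im R)) => // -[a b] [c d]. Qed.

(** The real and imaginary parts are dominated by the modulus, so both real
    series converge absolutely; this reduces to the completeness of the reals. *)
Lemma cvg_series_complex u :
  cvgn (series (fun n => cabs (u n))) -> cvgn (series (u : nat -> R[i]^o)).
Proof.
move=> cu.
have cRe : cvgn (series (fun n => complex.Re (u n))).
  apply: normed_cvg; apply: series_le_cvg cu => n.
  - exact: normr_ge0.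
  - exact: cabs_ge0.
  - exact: normr_Re_le.
have cIm : cvgn (series (fun n => complex.Im (u n))).
  apply: normed_cvg; apply: series_le_cvg cu => n.
  - exact: normr_ge0.
  - exact: cabs_ge0.
  - exact: normr_Im_le.
apply/cvg_ex; eexists; apply: cvg_complex.
  rewrite (_ : (fun n => _) = series (fun n => complex.Re (u n))).
    exact: cRe.
  by apply/funext => n; rewrite /series/= Re_sum.
rewrite (_ : (fun n => _) = series (fun n => complex.Im (u n))).
  exact: cIm.
by apply/funext => n; rewrite /series/= Im_sum.
Qed.

End ComplexSequences.

(** * The square-sum norm through partial sums *)

Section SquareSummableNorm.
Variable R : realType.
Implicit Types (u : nat -> R[i]) (C : R).

Lemma sqsum_partial u n :
  (\sum_(0 <= k < n) (cabs (u k) ^+ 2)%:E <= sqsum u)%E.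
Proof. by apply: nneseries_lim_ge => k _ _; rewrite lee_fin sqr_ge0. Qed.

Lemma sqsum_le u C :
  (forall n, \sum_(0 <= k < n) cabs (u k) ^+ 2 <= C) -> (sqsum u <= C%:E)%E.
Proof.
move=> uC; apply: lime_le.
  by apply: is_cvg_nneseries => n _ _; rewrite lee_fin sqr_ge0.
by apply: nearW => n; rewrite sumEFin lee_fin.
Qed.

Lemma sqsummable_le u C :
  (forall n, \sum_(0 <= k < n) cabs (u k) ^+ 2 <= C) -> u \in @sqsummable R.
Proof. by move=> /sqsum_le uC; rewrite inE (le_lt_trans uC) ?ltry. Qed.

Lemma l2norm_ge0 u : 0 <= l2norm u.
Proof. exact: sqrtr_ge0. Qed.

Lemma l2norm_sqr u : l2norm u ^+ 2 = fine (sqsum u).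
Proof. by rewrite sqr_sqrtr// fine_ge0// sqsum_ge0. Qed.

Lemma sqsumE u : u \in @sqsummable R -> sqsum u = (l2norm u ^+ 2)%:E.
Proof. by move=> us; rewrite l2norm_sqr fineK// sqsummable_fin. Qed.

Lemma l2norm_le u C : 0 <= C ->
  (forall n, \sum_(0 <= k < n) cabs (u k) ^+ 2 <= C ^+ 2) -> l2norm u <= C.
Proof.
move=> C0 uC; rewrite -(@ler_pXn2r _ 2) ?nnegrE ?l2norm_ge0//.
by rewrite -lee_fin -sqsumE ?sqsum_le// (sqsummable_le uC).
Qed.

Lemma l2norm_partial u n : u \in @sqsummable R ->
  \sum_(0 <= k < n) cabs (u k) ^+ 2 <= l2norm u ^+ 2.
Proof. by move=> us; rewrite -lee_fin -sqsumE// -sumEFin sqsum_partial. Qed.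

Lemma cvg_l2norm_sqr u : u \in @sqsummable R ->
  series (fun n => cabs (u n) ^+ 2) @ \oo --> l2norm u ^+ 2.
Proof.
move=> us; suff: (fun n => (series (fun k => cabs (u k) ^+ 2) n)%:E) @ \oo -->
    (l2norm u ^+ 2)%:E by move/fine_cvg; exact.
rewrite -sqsumE//.
have : (fun n => \sum_(0 <= k < n) (cabs (u k) ^+ 2)%:E)%E @ \oo --> sqsum u.
  by apply: is_cvg_nneseries => n _ _; rewrite lee_fin sqr_ge0.
by apply: cvg_trans; apply: near_eq_cvg; apply: nearW => n; rewrite sumEFin.
Qed.

Lemma cabs_le_l2norm u k : u \in @sqsummable R -> cabs (u k) <= l2norm u.
Proof.
move=> us; rewrite -(@ler_pXn2r _ 2) ?nnegrE ?l2norm_ge0 ?cabs_ge0//.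
apply: le_trans (l2norm_partial k.+1 us).
by rewrite big_nat_recr//= lerDr sumr_ge0// => i _; rewrite sqr_ge0.
Qed.

End SquareSummableNorm.

(** * Sesquilinearity of the inner product and Pythagoras *)

Section InnerProduct.
Variable R : realType.
Local Notation H := (ell2 R).
Implicit Types (f g h : H) (c : R[i]).

(** The products are absolutely summable because
    |x y| <= |x|^2 + |y|^2; every algebraic property of [inner] below comes from
    this convergence and the uniqueness of limits. *)
Lemma inner_cvg f g :
  series (fun n => f n * conjc (g n) : R[i]^o) @ \oo --> (inner f g : R[i]^o).
Proof.
suff cfg : cvgn (series (fun n => cabs (f n * conjc (g n)))).
  exact: (cvg_series_complex cfg).
apply: (@series_le_cvg _ _ (fun n => cabs (f n) ^+ 2 + cabs (g n) ^+ 2)).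
- by move=> n; exact: cabs_ge0.
- by move=> n; rewrite addr_ge0 ?sqr_ge0.
- move=> n; rewrite Normc.normcM cabs_conj.
  by have := cabs_ge0 (f n); have := cabs_ge0 (g n); nra.
suff: series (fun n => cabs (f n) ^+ 2 + cabs (g n) ^+ 2) @ \oo -->
    l2norm f ^+ 2 + l2norm g ^+ 2 by move/cvgP.
rewrite [series _](_ : _ = series (fun n => cabs (f n) ^+ 2) \+
    series (fun n => cabs (g n) ^+ 2)); last first.
  by apply/funext => n; rewrite /series/= big_split.
by apply: cvgD; apply: cvg_l2norm_sqr; exact: ell2P.
Qed.

Lemma inner_unique f g c :
  series (fun n => f n * conjc (g n) : R[i]^o) @ \oo --> (c : R[i]^o) ->
  inner f g = c.
Proof. exact/cvg_lim/norm_hausdorff. Qed.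

Lemma inner_linear_left g c f h :
  inner (c *: f + h) g = c * inner f g + inner h g.
Proof.
apply: inner_unique.
rewrite [series _](_ : _ = (fun n => c * series (fun k => f k * conjc (g k)) n)
    \+ series (fun k => h k * conjc (g k))); last first.
  apply/funext => n; rewrite /series/= mulr_sumr -big_split.
  by apply: eq_bigr => k _ /=; rewrite mulrDl mulrA.
by apply: cvgD; [apply: cvgMl_tmp|]; exact: inner_cvg.
Qed.

Lemma inner_linear_right f c g h :
  inner f (c *: g + h) = conjc c * inner f g + inner f h.
Proof.
apply: inner_unique.
rewrite [series _](_ : _ =
    (fun n => conjc c * series (fun k => f k * conjc (g k)) n)
    \+ series (fun k => f k * conjc (h k))); last first.
  apply/funext => n; rewrite /series/= mulr_sumr -big_split.
  by apply: eq_bigr => k _ /=; rewrite rmorphD rmorphM/= mulrDr mulrCA.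
by apply: cvgD; [apply: cvgMl_tmp|]; exact: inner_cvg.
Qed.

Lemma inner0l g : inner 0 g = 0.
Proof.
have := inner_linear_left g (-1) 0 0.
by rewrite scaler0 addr0 mulN1r addNr.
Qed.

Lemma inner0r f : inner f 0 = 0.
Proof.
have := inner_linear_right f (-1) 0 0.
by rewrite scaler0 addr0 rmorphN1 mulN1r addNr.
Qed.

Lemma innerZr c f g : inner f (c *: g) = conjc c * inner f g.
Proof. by rewrite -[_ *: _]addr0 inner_linear_right inner0r addr0. Qed.

Lemma inner_suml (I : Type) (s : seq I) (c : I -> R[i]) (v : I -> H) g :
  inner (\sum_(i <- s) c i *: v i) g = \sum_(i <- s) c i * inner (v i) g.
Proof.
elim: s => [|i s IH]; first by rewrite !big_nil inner0l.
by rewrite !big_cons inner_linear_left IH.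
Qed.

Lemma inner_sumr (I : Type) (s : seq I) (c : I -> R[i]) (v : I -> H) f :
  inner f (\sum_(i <- s) c i *: v i) =
  \sum_(i <- s) conjc (c i) * inner f (v i).
Proof.
elim: s => [|i s IH]; first by rewrite !big_nil inner0r.
by rewrite !big_cons inner_linear_right IH.
Qed.

Lemma inner_self f : inner f f = (l2norm f ^+ 2)%:C.
Proof.
apply: inner_unique.
rewrite [series _](_ : _ = fun n => (series (fun k => cabs (f k) ^+ 2) n)%:C).
  exact: cvg_real_complex (cvg_l2norm_sqr (ell2P f)).
apply/funext => n; rewrite /series/= rmorph_sum.
by apply: eq_bigr => k _; rewrite mulc_conj.
Qed.

Lemma pythagoras (I : choiceType) (v : I -> H) (s : seq I) (c : I -> R[i]) :
  Defs.orthonormal v -> uniq s ->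
  l2norm (\sum_(i <- s) c i *: v i) ^+ 2 = \sum_(i <- s) cabs (c i) ^+ 2.
Proof.
move=> vo us; apply: complexI; rewrite -inner_self inner_suml rmorph_sum/=.
rewrite big_seq [RHS]big_seq; apply: eq_bigr => i si.
rewrite inner_sumr (bigD1_seq i)//= vo eqxx mulr1 big1 ?addr0.
  by rewrite mulc_conj.
by move=> j ji; rewrite vo eq_sym (negbTE ji) mulr0.
Qed.

Lemma inner_std_basisr f k : inner f (std_basis R k) = f k.
Proof.
apply: inner_unique; apply: cvg_near_cst; exists k.+1 => // n /= kn.
rewrite /series/= (bigD1_seq k) ?mem_index_iota ?iota_uniq//=.
rewrite eqxx rmorph1 mulr1 big1 ?addr0// => i /negbTE ->.
by rewrite rmorph0 mulr0.
Qed.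

Lemma inner_std_basisl g k : inner (std_basis R k) g = conjc (g k).
Proof.
apply: inner_unique; apply: cvg_near_cst; exists k.+1 => // n /= kn.
rewrite /series/= (bigD1_seq k) ?mem_index_iota ?iota_uniq//=.
by rewrite eqxx mul1r big1 ?addr0// => i /negbTE ->; rewrite mul0r.
Qed.

Lemma std_basis_orthonormal : Defs.orthonormal (std_basis R).
Proof. by move=> i j; rewrite inner_std_basisr eq_sym. Qed.

End InnerProduct.

(** * Completeness of l^2 and convergence of orthonormal series *)

Section Ell2Limits.
Variable R : realType.
Local Notation H := (ell2 R).
Implicit Types (f g : H) (e : R).

Lemma ell2_sumE (s : seq nat) (c : nat -> R[i]) (v : nat -> H) k :
  (\sum_(i <- s) c i *: v i) k = \sum_(i <- s) c i * v i k.
Proof. by apply: (big_morph (fun f : H => f k)). Qed.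

Lemma l2norm_distC f g : l2norm (ell2_val (f - g)) = l2norm (ell2_val (g - f)).
Proof. by apply: complexI; exact: (distrC f g). Qed.

Lemma l2norm_triangle f g h :
  l2norm (ell2_val (f - g)) <=
  l2norm (ell2_val (f - h)) + l2norm (ell2_val (h - g)).
Proof.
by rewrite -(subrKA h f (- g)); apply: l2normD; exact: ell2P.
Qed.

Lemma l2norm_partialB f g n :
  \sum_(0 <= k < n) cabs (f k - g k) ^+ 2 <= l2norm (ell2_val (f - g)) ^+ 2.
Proof. exact: (l2norm_partial n (ell2P (f - g))). Qed.

Lemma cabs_leB_l2norm f g k :
  cabs (f k - g k) <= l2norm (ell2_val (f - g)).
Proof. exact: (cabs_le_l2norm k (ell2P (f - g))). Qed.

(** Coordinates of a Cauchy sequence are Cauchy, hence converge. The bound on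
    the distance to the limit passes to it because each partial sum of squares
    involves only finitely many coordinates. *)
Lemma ell2_complete (s : nat -> H) :
  (forall e, 0 < e -> exists N, forall n, (N <= n)%N ->
     l2norm (ell2_val (s n - s N)) <= e) ->
  exists g : H, forall e, 0 < e -> exists N, forall n, (N <= n)%N ->
     l2norm (ell2_val (s n - g)) <= e.
Proof.
move=> sC.
have coord (P : R[i] -> R) : (forall x y, P (x - y) = P x - P y) ->
    (forall z, `|P z| <= cabs z) -> forall k, cvgn (fun n => P (s n k)).
  move=> PB Ple k; apply: cauchy_cvg; apply: cauchy_exP => e e0.
  have [N sN] := sC _ (divr_gt0 e0 (ltr0n R 2)).
  exists (P (s N k)); exists N => // n /sN le_e2.
  rewrite -ball_normE/= distrC -PB.
  apply: le_lt_trans (Ple _) _.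
  apply: le_lt_trans (cabs_leB_l2norm (s n) (s N) k) _.
  by apply: le_lt_trans le_e2 _; lra.
have cRe := coord (@complex.Re R) (@Re_sub R) (@normr_Re_le R).
have cIm := coord (@complex.Im R) (@Im_sub R) (@normr_Im_le R).
pose g0 k := limn (fun n => complex.Re (s n k)) +i*
  limn (fun n => complex.Im (s n k)).
have cvg_dist n k :
    (fun m => cabs (s n k - s m k) ^+ 2) @ \oo --> cabs (s n k - g0 k) ^+ 2.
  under eq_fun do rewrite cabs_sqr !expr2; rewrite cabs_sqr !expr2.
  under eq_fun do rewrite Re_sub Im_sub; rewrite Re_sub Im_sub.
  apply: cvgD.
    have cn : (fun m => complex.Re (s n k) - complex.Re (s m k)) @ \oo -->
        complex.Re (s n k) - complex.Re (g0 k).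
      by apply: cvgB; [exact: cvg_cst|exact: cRe].
    exact: (cvgM cn cn).
  have cn : (fun m => complex.Im (s n k) - complex.Im (s m k)) @ \oo -->
      complex.Im (s n k) - complex.Im (g0 k).
    by apply: cvgB; [exact: cvg_cst|exact: cIm].
  exact: (cvgM cn cn).
(* let m tend to infinity in the partial sums of |s n - s m|^2 *)
have close e : 0 < e -> exists N, forall n, (N <= n)%N -> forall K,
    \sum_(0 <= k < K) cabs (s n k - g0 k) ^+ 2 <= e ^+ 2.
  move=> e0; have [N sN] := sC _ (divr_gt0 e0 (ltr0n R 2)).
  exists N => n Nn K.
  have cvgK : (fun m => \sum_(0 <= k < K) cabs (s n k - s m k) ^+ 2) @ \oo -->
      \sum_(0 <= k < K) cabs (s n k - g0 k) ^+ 2.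
    by apply: cvg_big => [|k _]; [exact: add_continuous|exact: cvg_dist].
  apply: (cvgr_to_le cvgK); exists N => // m /= Nm.
  apply: le_trans (l2norm_partialB (s n) (s m) K) _.
  rewrite ler_pXn2r ?nnegrE ?l2norm_ge0 ?(ltW e0)//.
  apply: le_trans (l2norm_triangle _ _ (s N)) _.
  by rewrite (l2norm_distC (s N)) [leRHS]splitr lerD ?sN.
(* g0 differs from s N by a square-summable sequence *)
have g0P : g0 \in @sqsummable R.
  have [N closeN] := close 1 ltr01.
  have dP : (fun k => s N k - g0 k) \in @sqsummable R.
    by apply: (@sqsummable_le _ _ (1 ^+ 2)); exact: closeN.
  rewrite (_ : g0 = (s N : nat -> R[i]) - (fun k => s N k - g0 k)).
    by rewrite rpredB ?ell2P.
  by apply/funext => k; change (g0 k = s N k - (s N k - g0 k)); rewrite subKr.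
exists (Ell2 g0P) => e e0; have [N closeN] := close e e0.
by exists N => n Nn; apply: l2norm_le; [exact: ltW|exact: closeN].
Qed.

Lemma l2_tail f e : 0 < e -> exists N, forall n m, (N <= n)%N ->
  \sum_(n <= k < m) cabs (f k) ^+ 2 <= e ^+ 2.
Proof.
move=> e0; have /cvgrPdist_le/(_ (e ^+ 2)) := cvg_l2norm_sqr (ell2P f).
case=> [|N _ tailN]; first by rewrite exprn_gt0.
exists N => n m Nn; have [mn|nm] := leqP m n; first by rewrite big_geq ?sqr_ge0.
apply: le_trans (tailN n Nn).
rewrite ger0_norm ?subr_ge0; last by apply: l2norm_partial; exact: ell2P.
rewrite lerBrDr addrC /series/= -big_cat_nat ?(ltnW nm)//=.
by apply: l2norm_partial; exact: ell2P.
Qed.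

Lemma l2norm_orthonormal_sum (b : nat -> H) (c : nat -> R[i]) n m C :
  Defs.orthonormal b -> 0 <= C ->
  (l2norm (\sum_(n <= k < m) c k *: b k) <= C) =
  (\sum_(n <= k < m) cabs (c k) ^+ 2 <= C ^+ 2).
Proof.
move=> bo C0; rewrite -(@ler_pXn2r _ 2) ?nnegrE ?l2norm_ge0//.
by rewrite pythagoras// iota_uniq.
Qed.

(** By Pythagoras the blocks of the series have the same norm as the blocks of
    [c], so the partial sums are Cauchy. *)
Lemma orthonormal_synthesis (b : nat -> H) (c : H) : Defs.orthonormal b ->
  exists g : H, forall e, 0 < e -> exists N, forall n, (N <= n)%N ->
    l2norm (ell2_val (\sum_(0 <= k < n) c k *: b k - g)) <= e.
Proof.
move=> bo; apply: ell2_complete => e e0; have [N tailN] := l2_tail c e0.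
exists N => n Nn; rewrite (@big_cat_nat _ _ _ N)//= addrC addKr.
by rewrite l2norm_orthonormal_sum ?(ltW e0)//; exact: tailN.
Qed.

Lemma truncation_cvg f e : 0 < e -> exists N, forall n, (N <= n)%N ->
  l2norm (ell2_val (\sum_(0 <= k < n) f k *: std_basis R k - f)) <= e.
Proof.
move=> e0; have [N tailN] := l2_tail f e0; exists N => n Nn.
pose t := \sum_(0 <= k < n) f k *: std_basis R k.
have tE k : t k = if (k < n)%N then f k else 0.
  rewrite ell2_sumE; case: ifPn => kn.
    rewrite (bigD1_seq k) ?mem_index_iota ?iota_uniq//= eqxx mulr1.
    rewrite big1 ?addr0//.
    by move=> i; rewrite eq_sym => /negbTE ->; rewrite mulr0.
  rewrite big_nat big1// => i /andP[_ i_n] /=.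
  by case: eqP => [ki|_]; [rewrite ki i_n in kn|rewrite mulr0].
have dE k : (t - f) k = if (k < n)%N then 0 else - f k.
  change (t k - f k = if (k < n)%N then 0 else - f k).
  by rewrite tE; case: ifP; rewrite ?subrr ?sub0r.
apply: l2norm_le => [|K]; first exact: ltW.
apply: le_trans (tailN n (maxn n K) Nn).
apply: (@le_trans _ _ (\sum_(0 <= k < maxn n K) cabs ((t - f) k) ^+ 2)).
  rewrite [leRHS](@big_cat_nat _ _ _ K) ?leq_maxr//= lerDl.
  by rewrite sumr_ge0// => i _; exact: sqr_ge0.
under eq_bigr do rewrite dE.
rewrite (@big_cat_nat _ _ _ n) ?leq_maxl//=.
rewrite big_nat big1 ?add0r => [|k /andP[_ ->]]; last first.
  by rewrite Normc.normc0 expr0n.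
rewrite big_nat [leRHS]big_nat ler_sum// => k /andP[nk _].
by rewrite ltnNge nk complex.normcN.
Qed.

Lemma std_basis_dense : dense (lin_span (std_basis R)).
Proof.
move=> O [f Of]; rewrite openE => /(_ f Of)/nbhs_ballP[e /= e0 feO].
have eE : e = (complex.Re e)%:C by rewrite RRe_real// gtr0_real.
have re0 : 0 < complex.Re e / 2 by rewrite divr_gt0// -ltcR -eE.
have [N /(_ N (leqnn N)) fN] := truncation_cvg f re0.
exists (\sum_(0 <= k < N) f k *: std_basis R k); split; last first.
  by exists (index_iota 0 N), f.
apply: feO; rewrite -ball_normE/= distrC eE ltcR.
by apply: le_lt_trans fN _; move: re0; lra.
Qed.

End Ell2Limits.

(** * Diagonal operators *)

Section DiagonalOperator.
Variable R : realType.
Local Notation H := (ell2 R).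
Variable a : nat -> R[i].
Hypothesis a_le1 : forall n, cabs (a n) <= 1.

Let diag_partial (f : H) n :
  \sum_(0 <= k < n) cabs (a k * f k) ^+ 2 <= l2norm f ^+ 2.
Proof.
apply: le_trans (l2norm_partial n (ell2P f)); apply: ler_sum => k _.
rewrite ler_pXn2r ?nnegrE ?cabs_ge0// Normc.normcM.
by rewrite ler_piMl ?cabs_ge0.
Qed.

Definition diag_op (f : H) : H :=
  Ell2 (sqsummable_le (diag_partial f)).

Fact diag_op_linear : linear diag_op.
Proof. by move=> c f g; apply/val_inj/funext => k /=; rewrite mulrDr mulrCA. Qed.

HB.instance Definition _ :=
  GRing.isLinear.Build R[i] H H _ diag_op diag_op_linear.

Lemma diag_op_bounded : bounded_linear diag_op.
Proof.
exists 1 => f; rewrite mul1r lecR.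
by apply: l2norm_le; [exact: l2norm_ge0|exact: diag_partial].
Qed.

Lemma diag_op_inj : (forall n, a n != 0) -> injective diag_op.
Proof.
move=> a0 f g fg; apply/val_inj/funext => k; apply: (mulfI (a0 k)).
exact: (congr1 (fun h : H => h k) fg).
Qed.

Lemma diag_op_std_basis n : diag_op (std_basis R n) = a n *: std_basis R n.
Proof.
apply/val_inj/funext => k; change (a k * (k == n)%:R = a n * (k == n)%:R).
by case: eqP => [->|_]; rewrite ?mulr0.
Qed.

End DiagonalOperator.

(** * The vector with coordinates 1/(n+1) *)

Section HarmonicVector.
Variable R : realType.
Local Notation H := (ell2 R).

(** Comparison with the telescoping sum of
    1/((k+1)(k+2)) = 1/(k+1) - 1/(k+2). *)
Lemma inv_sqr_partial n : \sum_(0 <= k < n) (k.+1%:R^-1) ^+ 2 <= 2 :> R.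
Proof.
suff sum_le : \sum_(0 <= k < n.+1) (k.+1%:R^-1) ^+ 2 <= 2 - n.+1%:R^-1 :> R.
  apply: (@le_trans _ _ (2 - n.+1%:R^-1)); last by rewrite gerBl invr_ge0.
  by apply: le_trans sum_le; rewrite big_nat_recr//= lerDl sqr_ge0.
elim: n => [|n IH]; first by rewrite big_nat1 invr1 expr1n; lra.
have gap : n.+1%:R^-1 - n.+2%:R^-1 = n.+1%:R^-1 * n.+2%:R^-1 :> R.
  rewrite -[n.+2%:R]natr1; have : 0 < n.+1%:R :> R by [].
  move: (n.+1%:R : R) => x x0.
  have x1 : x + 1 != 0 by rewrite lt0r_neq0// addr_gt0.
  by field; rewrite x1 lt0r_neq0.
have le_inv : n.+2%:R^-1 <= n.+1%:R^-1 :> R.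
  by rewrite lef_pV2 ?posrE ?ltr0n// ler_nat.
have inv_ge0 : 0 <= n.+2%:R^-1 :> R by rewrite invr_ge0.
have := ler_wpM2r inv_ge0 le_inv; rewrite big_nat_recr//= expr2.
move: (\sum_(_ <= _ < _) _) (n.+1%:R^-1 : R) (n.+2%:R^-1 : R) IH gap => S p q.
by lra.
Qed.

Fact harmonic_sqsummable :
  (fun n => (n.+1%:R : R[i])^-1) \in @sqsummable R.
Proof.
apply: (@sqsummable_le _ _ 2) => n.
under eq_bigr do rewrite Normc.normcV cabs_natr.
exact: inv_sqr_partial.
Qed.

Definition harmonic_vector : H := Ell2 harmonic_sqsummable.

Lemma cabs_harmonic n : cabs (harmonic_vector n) = n.+1%:R^-1.
Proof. by rewrite Normc.normcV cabs_natr. Qed.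

End HarmonicVector.

(** * The sequences (n+1) e_n and e_n/(n+1) *)

Section Sequences.
Variable R : realType.
Local Notation H := (ell2 R).
Local Notation e := (std_basis R).
Local Notation up := (fun n : nat => (n.+1%:R : R[i]) *: e n).
Local Notation down := (fun n : nat => (n.+1%:R : R[i])^-1 *: e n).

Lemma bounded_linear_real (B : {linear H -> H}) : bounded_linear B ->
  exists2 M : R, 0 <= M & forall f, l2norm (B f) <= M * l2norm f.
Proof.
case=> M BM; exists `|M| => // f.
have /le_trans : l2norm (B f) <= M * l2norm f.
  by rewrite -lecR rmorphM; exact: BM.
by apply; rewrite ler_wpM2r ?l2norm_ge0 ?ler_norm.
Qed.

Lemma natC_neq0 n : n.+1%:R != 0 :> R[i].
Proof. by rewrite pnatr_eq0. Qed.

Lemma up_ICO : ICO_sequence up.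
Proof.
have a_le1 n : cabs (harmonic_vector R n) <= 1.
  by rewrite cabs_harmonic invf_le1 ?ltr0n// ler1n.
exists (diag_op a_le1); split.
- exact: diag_op_bounded.
- by apply: diag_op_inj => n; rewrite invr_neq0 ?natC_neq0.
have -> : diag_op a_le1 \o up = e.
  apply/funext => n /=; rewrite linearZ/= diag_op_std_basis scalerA.
  by rewrite mulfV ?natC_neq0 ?scale1r.
by split; [exact: std_basis_orthonormal|exact: std_basis_dense].
Qed.

(** The vector outside the range is the sum of b_n / (n+1), where b_n is the
    image of (n+1) e_n: formally it is the image of the constant sequence 1. *)
Lemma orthonormal_up_not_surjective (B : {linear H -> H}) :
  bounded_linear B -> Defs.orthonormal (B \o up) ->
  ~ (forall g, exists f, B f = g).
Proof.
move=> /bounded_linear_real[M M0 BM] bo Bsurj.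
set b := B \o up in bo.
have Be n : B (e n) = harmonic_vector R n *: b n.
  by rewrite /b/= linearZ/= scalerA mulVf ?natC_neq0 ?scale1r.
have [g sg] := orthonormal_synthesis (harmonic_vector R) bo.
have [f Bf] := Bsurj g.
(* B t - s tends to B f - g = 0, and by Pythagoras its norm bounds each of its
   coefficients (f k - 1)/(k+1) along b *)
have f1 k : f k = 1.
  have /eqP : cabs ((f k - 1) * harmonic_vector R k) = 0.
    apply/eqP; rewrite eq_le cabs_ge0 andbT; apply/ler_addgt0Pr => eps eps0.
    rewrite add0r.
    have M1 : 0 < M + 1 by rewrite ltr_wpDl.
    (* the errors in B t and in s will be M and 1 times this quantity *)
    have d0 : 0 < eps / (M + 1) by rewrite divr_gt0.
    have [N1 fN1] := truncation_cvg f d0; have [N2 sN2] := sg _ d0.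
    pose N := maxn k.+1 (maxn N1 N2).
    have kN : (k < N)%N by rewrite /N leq_max leqnn.
    have N1N : (N1 <= N)%N by rewrite /N !leq_max leqnn orbT.
    have N2N : (N2 <= N)%N by rewrite /N !leq_max leqnn !orbT.
    set t := \sum_(0 <= n < N) f n *: e n in fN1.
    pose s := \sum_(0 <= n < N) harmonic_vector R n *: b n.
    have BtE : B t - s =
        \sum_(0 <= n < N) ((f n - 1) * harmonic_vector R n) *: b n.
      rewrite linear_sum/= -sumrB; apply: eq_bigr => n _.
      by rewrite linearZ/= Be scalerA -scalerBl mulrBl mul1r.
    have Bts : l2norm (ell2_val (B t - s)) <= eps.
      apply: le_trans (l2norm_triangle _ _ g) _.
      rewrite -{1}Bf -linearB l2norm_distC.
      apply: (@le_trans _ _ (M * (eps / (M + 1)) + eps / (M + 1))).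
        rewrite lerD//.
          by rewrite (le_trans (BM _))// ler_wpM2l// fN1.
        exact: sN2.
      by rewrite -{2}[_ / _]mul1r -mulrDl mulrC divfK// gt_eqF.
    rewrite -(@ler_pXn2r _ 2) ?nnegrE ?cabs_ge0 ?(ltW eps0)//.
    move: Bts; rewrite BtE l2norm_orthonormal_sum ?(ltW eps0)//.
    apply: le_trans; rewrite (bigD1_seq k) ?mem_index_iota ?iota_uniq//=.
    by rewrite lerDl sumr_ge0// => i _; exact: sqr_ge0.
  rewrite Normc.normcM cabs_harmonic mulf_eq0 invr_eq0 pnatr_eq0 orbF => /eqP.
  by move/Normc.eq0_normc/eqP; rewrite subr_eq0 => /eqP.
(* the squared norm of f would exceed every natural number *)
have := l2norm_partial (Num.truncn (l2norm f ^+ 2)).+1 (ell2P f).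
under eq_bigr do rewrite f1 Normc.normc1 expr1n.
by rewrite sumr_const_nat subn0 leNgt truncnS_gt.
Qed.

(** Double counting of the entries |<e_k, B d_n>|^2: the Parseval identity at
    e_k makes each row sum equal to 1, while the column sums are at most
    M^2/(n+1)^2, a convergent series. *)
Lemma down_not_CFC : ~ CFC_sequence down.
Proof.
case=> B [/bounded_linear_real[M M0 BM] parseval].
have norm_e k : l2norm (e k) ^+ 2 = 1.
  by apply: complexI; rewrite -inner_self std_basis_orthonormal eqxx.
have row k : (\sum_(0 <= n <oo) (cabs (B (down n) k) ^+ 2)%:E = 1 :> \bar R)%E.
  have := parseval (e k).
  rewrite norm_e -nneseries_esumT => [<-|n]; last by rewrite lee_fin sqr_ge0.
  by apply: eq_eseriesr => n _; rewrite /= inner_std_basisl cabs_conj.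
have col n : (\sum_(0 <= k <oo) (cabs (B (down n) k) ^+ 2)%:E <=
    (M ^+ 2)%:E * (cabs (harmonic_vector R n) ^+ 2)%:E)%E.
  rewrite -[leLHS]/(sqsum (B (down n))) sqsumE ?ell2P// -EFinM lee_fin -exprMn.
  rewrite ler_pXn2r ?nnegrE ?l2norm_ge0 ?mulr_ge0 ?cabs_ge0//.
  apply: le_trans (BM _) _; rewrite ler_wpM2l// l2normZ ?ell2P//.
  have /eqP := norm_e n; rewrite sqrf_eq1 => /orP[/eqP ->|/eqP eN1].
    by rewrite mulr1.
  by have := l2norm_ge0 (e n); rewrite eN1 oppr_ge0 ler10.
pose K := (Num.truncn (M ^+ 2 * l2norm (harmonic_vector R) ^+ 2)).+1.
have : (K%:R%:E <= (M ^+ 2 * l2norm (harmonic_vector R) ^+ 2)%:E :> \bar R)%E.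
  apply: (@le_trans _ _ (\sum_(0 <= k <oo) \sum_(0 <= n <oo)
      (cabs (B (down n) k) ^+ 2)%:E)%E).
    have -> : K%:R%:E = (\sum_(0 <= k < K) \sum_(0 <= n <oo)
        (cabs (B (down n) k) ^+ 2)%:E)%E :> \bar R.
      under eq_bigr do rewrite row.
      by rewrite sumEFin sumr_const_nat subn0.
    by apply: nneseries_lim_ge => k _ _; rewrite row.
  rewrite nneseries_interchange => [|k n]; last by rewrite lee_fin sqr_ge0.
  rewrite EFinM -sqsumE ?ell2P// -nneseriesZl => [|n _]; last first.
    by rewrite lee_fin sqr_ge0.
  apply: lee_nneseries => [n _ _|n _]; last exact: col.
  by apply: nneseries_ge0 => k _ _; rewrite lee_fin sqr_ge0.
by rewrite lee_fin leNgt truncnS_gt.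
Qed.

Lemma esum_nat_sum (F : nat + nat -> \bar R) : (forall k, 0 <= F k)%E ->
  (\esum_(k in [set: nat + nat]) F k =
   \sum_(0 <= n <oo) F (inl n) + \sum_(0 <= n <oo) F (inr n))%E.
Proof.
move=> F0; rewrite (esumID (range inl))// setTI setTI.
have -> : ~` range inl = range inr :> set (nat + nat).
  apply/seteqP; split=> [[n|n]|_ [n _ <-]] //=; last by case.
    by case; exists n.
  by exists n.
by rewrite !esum_image ?nneseries_esumT// => m n _ _ [].
Qed.

(** The multiplier is chosen so that its squared modulus 1 / d n cancels the
    weight (n+1)^2 + (n+1)^-2 which e_n receives from the two families. *)
Lemma union_CFC : CFC_sequence (family_union up down).
Proof.
pose d n : R := n.+1%:R ^+ 2 + n.+1%:R ^- 2.
have d_ge1 n : 1 <= d n.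
  rewrite /d -[leLHS]addr0 lerD ?invr_ge0 ?sqr_ge0//.
  by rewrite exprn_ege1// ler1n.
pose a n : R[i] := ((Num.sqrt (d n))^-1)%:C.
have cabs_a n : cabs (a n) ^+ 2 = (d n)^-1.
  rewrite cabs_real ger0_norm ?invr_ge0 ?sqrtr_ge0// exprVn sqr_sqrtr//.
  exact: le_trans (d_ge1 n).
have a_le1 n : cabs (a n) <= 1.
  rewrite -(@ler_pXn2r _ 2) ?nnegrE ?cabs_ge0// cabs_a expr1n.
  by rewrite invf_le1 ?d_ge1// (lt_le_trans ltr01 (d_ge1 n)).
exists (diag_op a_le1); split; first exact: diag_op_bounded.
move=> f; rewrite esum_nat_sum => [|k]; last by rewrite lee_fin sqr_ge0.
rewrite -nneseriesD//=; last 2 first.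
- by move=> n _ _; rewrite lee_fin sqr_ge0.
- by move=> n _ _; rewrite lee_fin sqr_ge0.
rewrite -(sqsumE (ell2P f)); apply: eq_eseriesr => n _.
rewrite !linearZ/= diag_op_std_basis !innerZr inner_std_basisr.
rewrite !Normc.normcM !exprMn !cabs_conj -EFinD; congr EFin.
rewrite Normc.normcV cabs_natr cabs_a exprVn -!mulrDl -/(d n).
by rewrite mulrA divff ?mul1r// gt_eqF// (lt_le_trans ltr01 (d_ge1 n)).
Qed.

(** Both families have e_0 at index 0, so its image would be orthogonal to
    itself and of norm 1. *)
Lemma union_not_CO : ~ CO_sequence (family_union up down).
Proof.
case=> B [_ [vo _]].
have eq0 : family_union up down (inl 0%N) = family_union up down (inr 0%N).
  by rewrite /= invr1.
have := vo (inl 0%N) (inl 0%N).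
rewrite [X in inner _ X]/comp [in X in inner _ X]eq0.
rewrite (vo (inl 0%N) (inr 0%N)) eqxx.
by move/eqP; rewrite eq_sym oner_eq0.
Qed.

End Sequences.

Theorem corollary5p1 (R : realType) :
  let e := @std_basis R in
  let up := fun n : nat => (n.+1%:R : R[i]) *: e n in
  let down := fun n : nat => (n.+1%:R : R[i])^-1 *: e n in
  [/\ ICO_sequence up /\ ~ SCO_sequence up,
      ~ CFC_sequence down &
      CFC_sequence (family_union up down) /\
      ~ CO_sequence (family_union up down)].
Proof.
split; [split; first exact: up_ICO|exact: down_not_CFC|split].
- by case=> B [Bb Bsurj [Bo _]]; exact: (orthonormal_up_not_surjective Bb Bo).
- exact: union_CFC.
- exact: union_not_CO.
Qed.
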